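(* Let $n\ge2$, $K\ge1$, and let $\mathbf{Y}=(\mathbf{Y}^1,\dots,\mathbf{Y}^n)$ be an i.i.d. sample of integrable random vectors in $\mathbb{R}^K$ with common mean $\mu$, symmetric with respect to $\mu$ (i.e. $\mathbf{Y}^i-\mu$ and $\mu-\mathbf{Y}^i$ have the same distribution). Fix $\delta,\alpha\in(0,1)$. Let $f:(\mathbb{R}^K)^n\to[0,\infty)$ be a nonnegative measurable function, and let $\phi:\mathbb{R}^K\to\mathbb{R}$ be a nonnegative, subadditive, positive-homogeneous function. Denote $\widetilde\phi(x)=\max(\phi(x),\phi(-x))$. Then $$\mathbb{P}\big[\phi(\overline{\mathbf{Y}}-\mu)>q_{\alpha(1-\delta)}(\phi,\mathbf{Y}-\overline{\mathbf{Y}})+f(\mathbf{Y})\big]\le\alpha+\mathbb{P}\left[\widetilde\phi(\overline{\mathbf{Y}}-\mu)>\frac{n}{2\overline{\mathcal B}\big(n,\frac{\alpha\delta}{2}\big)-n}\,f(\mathbf{Y})\right].$$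
   Context: $\overline{\mathbf{Y}}=\frac1n\sum_{i=1}^n\mathbf{Y}^i$. For a vector $v\in\mathbb{R}^K$, $\mathbf{Y}-v=(\mathbf{Y}^1-v,\dots,\mathbf{Y}^n-v)$. A function $\phi$ is subadditive if $\phi(x+x')\le\phi(x)+\phi(x')$ for all $x,x'$, and positive-homogeneous if $\phi(\lambda x)=\lambda\phi(x)$ for all $x$ and all $\lambda\ge0$. Resampled empirical quantile: for $\mathbf{y}=(\mathbf{y}^1,\dots,\mathbf{y}^n)\in(\mathbb{R}^K)^n$ and $\alpha\in(0,1)$, $$q_\alpha(\phi,\mathbf{y})=\inf\{x\in\mathbb{R}:\ \mathbb{P}_W[\phi(\overline{\mathbf{y}}_{[W]})>x]\le\alpha\},\qquad \overline{\mathbf{y}}_{[W]}=\frac1n\sum_{i=1}^nW_i\mathbf{y}^i,$$ where $W=(W_1,\dots,W_n)$ has i.i.d. Rademacher coordinates ($\pm1$ with probability $1/2$ each), independent of the data, and $\mathbb{P}_W$ is the probability over $W$ only ($\mathbf{y}$ fixed). For $\eta\in(0,1)$, $\overline{\mathcal B}(n,\eta)=\min\{k\in\{0,\dots,n\}:\ 2^{-n}\sum_{i=k+1}^n\binom ni<\eta\}$ is the upper quantile function of a binomial $(n,\frac12)$ variable. If $2\overline{\mathcal B}(n,\frac{\alpha\delta}2)-n=0$, the quotient $n/(2\overline{\mathcal B}(n,\frac{\alpha\delta}2)-n)$ is read as $+\infty$ and the event on the right-hand side is then empty. *)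

(* Defs.v *)
From HB Require Import structures.
From mathcomp Require Export all_boot all_order all_algebra.
From mathcomp Require Export all_classical all_reals all_analysis.

Set Implicit Arguments.
Unset Strict Implicit.
Unset Printing Implicit Defensive.

Import Order.TTheory GRing.Theory Num.Theory.
Import numFieldNormedType.Exports.

Local Open Scope classical_set_scope.
Local Open Scope ring_scope.

(* The Borel sigma-algebra of R^K, as the product sigma-algebra generated by
   the coordinate maps; same construction as the library's for K.-tuple R. *)
Section measurable_rV.
Context {R : realType} {K : nat}.

Let coord : 'I_K -> 'rV[R]_K -> measurableTypeR R := fun j x => x ord0 j.

Let rV_set0 : g_sigma_preimage coord set0.
Proof. exact: sigma_algebra0. Qed.

Let rV_setC A : g_sigma_preimage coord A -> g_sigma_preimage coord (~` A).
Proof. exact: sigma_algebraC. Qed.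

Let rV_bigcup (F : (set 'rV[R]_K)^nat) :
  (forall i, g_sigma_preimage coord (F i)) ->
  g_sigma_preimage coord (\bigcup_i (F i)).
Proof. exact: sigma_algebra_bigcup. Qed.

HB.instance Definition _ := @isMeasurable.Build default_measure_display
  'rV[R]_K (g_sigma_preimage coord) rV_set0 rV_setC rV_bigcup.

End measurable_rV.

Section independence.
Context {d d'} {T : measurableType d} {T' : measurableType d'} {R : realType}.

Definition mutually_independent (P : probability T R) (I : finType)
    (X : I -> T -> T') : Prop :=
  forall (J : {set I}) (B : I -> set T'), (forall i, measurable (B i)) ->
    P (\bigcap_(i in [set` J]) (X i @^-1` B i)) =
    (\prod_(i in J) P (X i @^-1` B i))%E.

Definition identically_distributed (P : probability T R) (I : Type)
    (X : I -> T -> T') : Prop :=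
  forall (i j : I) (B : set T'), measurable B ->
    P (X i @^-1` B) = P (X j @^-1` B).

Definition same_distribution (P : probability T R) (X Y : T -> T') : Prop :=
  forall B : set T', measurable B -> P (X @^-1` B) = P (Y @^-1` B).

End independence.

Definition rademacher {d} {T : measurableType d} {R : realType}
    (P : probability T R) (X : T -> R) : Prop :=
  P (X @^-1` [set 1]) = (2^-1)%:E /\ P (X @^-1` [set -1]) = (2^-1)%:E.

Definition subadditive {R : realType} {V : lmodType R} (phi : V -> R) : Prop :=
  forall x x' : V, phi (x + x') <= phi x + phi x'.

Definition positive_homogeneous {R : realType} {V : lmodType R}
    (phi : V -> R) : Prop :=
  forall (x : V) (lambda : R), 0 <= lambda -> phi (lambda *: x) = lambda * phi x.

Section samples.
Context {R : realType} {n K : nat}.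
Implicit Types (y : n.-tuple 'rV[R]_K) (phi : 'rV[R]_K -> R).

Definition sample_mean y : 'rV[R]_K := n%:R^-1 *: \sum_(i < n) tnth y i.

Definition recenter y (v : 'rV[R]_K) : n.-tuple 'rV[R]_K :=
  [tuple tnth y i - v | i < n].

Definition resampled_mean y (w : 'I_n -> R) : 'rV[R]_K :=
  n%:R^-1 *: \sum_(i < n) w i *: tnth y i.

Definition sym_max phi (x : 'rV[R]_K) : R := Num.max (phi x) (phi (- x)).

(* [PW] and [W] live on their own probability space, so that [PW] is the
   probability over the weights only, the sample [y] being fixed. *)
Definition resampled_quantile {d} {TW : measurableType d}
    (PW : probability TW R) (W : 'I_n -> TW -> R)
    (alpha : R) phi y : R :=
  inf [set x : R |
    (PW [set w | (phi (resampled_mean y (fun i => W i w)) > x)%R] <= alpha%:E)%E].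

End samples.

(* The default [ord_max] always satisfies the condition when [0 < eta]. *)
Definition binom_upper_quantile {R : realType} (n : nat) (eta : R) : nat :=
  [arg min_(k < (ord_max : 'I_n.+1) |
     (2^-1 ^+ n * \sum_(k.+1 <= i < n.+1) 'C(n, i)%:R < eta)%R) (k : nat)]%N.

(* Main.v *)
From HB Require Import structures.
Require Import Defs.
From mathcomp Require Import measurable_realfun.

(** Write [q_a(y)] for the resampled quantile at level [a]. The proof compares
    the computable quantile [q_(alpha (1 - delta))(Y - mean)] with the ideal one
    [q_alpha(Y - mu)], whose recentering is exact.

    The ideal quantile has level [alpha] by symmetrization
    ([resampled_quantile_level]): the law of [Y - mu] is invariant under changing
    the signs of its entries, the quantile is invariant too, so the empirical
    mean may be replaced by the mean resampled with uniformly random signs. Given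
    the data, this exceeds the quantile with probability at most [alpha], by
    definition of a quantile.

    If [phi (mean - mu)] exceeds [q_(alpha (1 - delta))(Y - mean) + f(Y)] but not
    [q_alpha(Y - mu)], then the ideal quantile exceeds the other one by more than
    [f(Y)]. Conditionally on the data, resampled means around [mu] and around the
    empirical mean differ by the average sign times [mean - mu], so subadditivity
    leaves an event of probability more than [alpha * delta] on which the average
    sign makes this difference larger than [f(Y)] ([quantile_recenter_gap]). The
    average sign is a centered and rescaled binomial variable, and reading off its
    upper quantile at [alpha * delta / 2], one half for each sign, gives
    [n * f(Y) < D * sym_max phi (mean - mu)] with
    [D = 2 * binom_upper_quantile n (alpha * delta / 2) - n]
    ([mean_sign_deviation]). As the left side is nonnegative, [D > 0], and this is
    the event on the right of the theorem. A union bound concludes.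

    Two technical points carry the rest. Probabilities over the weights are
    frequencies over the [2 ^ n] sign patterns ([rademacher_prob]), which makes the
    quantile an order statistic of a finite family ([resampled_quantile_le]).
    And all events are measurable because a finite sublinear function is
    measurable for the product sigma-algebra of R^K ([measurable_sublinear]). *)

Set Implicit Arguments.
Unset Strict Implicit.
Unset Printing Implicit Defensive.

Import Order.TTheory GRing.Theory Num.Theory.
Import numFieldNormedType.Exports.

Local Open Scope classical_set_scope.
Local Open Scope ring_scope.

(** * Measurability in R^K *)

Lemma measurable_bool_set d (T : measurableType d) (b : T -> bool) :
  measurable_fun setT b -> measurable [set t | b t].
Proof.
by move=> mb; rewrite -[X in measurable X]setTI; exact: (mb measurableT [set true]).
Qed.

Section vector_measurability.
Context {R : realType} {K : nat}.

Lemma measurable_coord (j : 'I_K) :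
  measurable_fun setT (fun x : 'rV[R]_K => x ord0 j).
Proof.
move=> _ B mB; rewrite setTI; apply: sub_sigma_algebra.
rewrite -bigcup_seq /=; exists j; first by rewrite /= mem_index_enum.
by exists B => //; rewrite setTI.
Qed.

Lemma measurable_fun_rV d (T : measurableType d) (g : T -> 'rV[R]_K) :
  (forall j, measurable_fun setT (fun t => g t ord0 j)) ->
  measurable_fun setT g.
Proof.
move=> mg; apply: (measurability (\big[setU/set0]_(j < K)
  preimage_set_system setT (fun x : 'rV[R]_K => x ord0 j : measurableTypeR R)
    measurable)); first by [].
move=> _ [C + <-]; rewrite -bigcup_seq => -[j _ [B mB <-]].
by rewrite !setTI -comp_preimage -[X in measurable X]setTI; exact: mg.
Qed.

Lemma measurable_resampled_mean d (T : measurableType d) n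
    (y : T -> n.-tuple 'rV[R]_K) (w : 'I_n -> T -> R) :
  measurable_fun setT y -> (forall i, measurable_fun setT (w i)) ->
  measurable_fun setT (fun t => resampled_mean (y t) (w ^~ t)).
Proof.
move=> my mw; apply: measurable_fun_rV => j.
rewrite (_ : (fun t => _) = fun t =>
  n%:R^-1 * \sum_(i < n) w i t * tnth (y t) i ord0 j); last first.
  apply/funext => t; rewrite !mxE summxE; congr (_ * _).
  by apply: eq_bigr => i _; rewrite mxE.
apply: measurable_funM => //; apply: measurable_sum => i.
apply: measurable_funM => //.
apply: (measurableT_comp (measurable_coord j)).
by have /measurable_fun_tnthP := my; exact.
Qed.

Lemma measurable_sample_mean n :
  measurable_fun setT (@sample_mean R n K).
Proof.
rewrite (_ : sample_mean = fun y => resampled_mean y (fun=> 1)).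
  exact: (measurable_resampled_mean (y := id) (w := fun _ _ => 1)).
apply/funext => y; congr (_ *: _).
by apply: eq_bigr => i _; rewrite scale1r.
Qed.

Lemma measurable_fun_rVZ d (T : measurableType d) c (g : T -> 'rV[R]_K) :
  measurable_fun setT g -> measurable_fun setT (fun t => c *: g t).
Proof.
move=> mg; apply: measurable_fun_rV => j.
rewrite (_ : (fun t => _) = fun t => c * g t ord0 j).
  by apply: measurable_funM => //; exact: (measurableT_comp (measurable_coord j)).
by apply/funext => t; rewrite mxE.
Qed.

Lemma measurable_fun_rVB d (T : measurableType d) (g h : T -> 'rV[R]_K) :
  measurable_fun setT g -> measurable_fun setT h ->
  measurable_fun setT (fun t => g t - h t).
Proof.
move=> mg mh; apply: measurable_fun_rV => j.
rewrite (_ : (fun t => _) = fun t => g t ord0 j - h t ord0 j); last first.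
  by apply/funext => t; rewrite !mxE.
by apply: measurable_funB; exact: (measurableT_comp (measurable_coord j)).
Qed.

Lemma sublinear0 (V : lmodType R) (phi : V -> R) :
  positive_homogeneous phi -> phi 0 = 0.
Proof. by move=> hom; rewrite -[X in phi X](scale0r 0) hom // mul0r. Qed.

Lemma sublinearZ_le (V : lmodType R) (phi : V -> R) a (v : V) :
  positive_homogeneous phi ->
  phi (a *: v) <= `|a| * (`|phi v| + `|phi (- v)|).
Proof.
move=> hom; have [a0|a0] := leP 0 a.
  by rewrite hom // ger0_norm // ler_wpM2l // (le_trans (ler_norm _)) // lerDl.
have na : 0 <= - a by rewrite oppr_ge0 ltW.
rewrite (ltr0_norm a0) -{1}[a]opprK scaleNr -scalerN hom // ler_wpM2l //.
by rewrite (le_trans (ler_norm _)) // lerDr.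
Qed.

(** A sublinear function on R^K is dominated by the sup norm: expand the vector
    on the canonical basis and use subadditivity. The constant collects the
    values of [phi] at plus and minus each basis vector. This is the only form
    of continuity of [phi] that the measurability proof uses. *)
Lemma sublinear_coord_bound (phi : 'rV[R]_K -> R) :
  subadditive phi -> positive_homogeneous phi ->
  exists2 c : R, 0 <= c & forall (x : 'rV[R]_K) (e : R), (forall j, `|x ord0 j| <= e) ->
    phi x <= c * e.
Proof.
move=> sub hom; pose b (j : 'I_K) : R :=
  `|phi (delta_mx 0 j)| + `|phi (- delta_mx 0 j)|.
exists (\sum_j b j); first by apply: sumr_ge0 => j _; rewrite addr_ge0.
move=> x e xe; rewrite (row_sum_delta x) mulr_suml.
apply: (@le_trans _ _ (\sum_j phi (x 0 j *: delta_mx 0 j))).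
  elim/big_ind2: _ => // [|u v u' v' uv uv']; first by rewrite sublinear0.
  exact: le_trans (sub _ _) (lerD uv uv').
apply: ler_sum => j _; apply: (le_trans (sublinearZ_le _ _ hom)).
by rewrite mulrC; apply: ler_wpM2l; rewrite ?addr_ge0.
Qed.

(** By the sup norm bound, [{phi < a}] is the union, over the grids of mesh
    [1 / (m + 1)] and the grid points [g] with [phi g + c / (m + 1) < a], of the
    closed cubes of radius [1 / (m + 1)] around [g]. The union is countable and
    each cube is an intersection of coordinate constraints, so the set lies in
    the product sigma-algebra, and open sets of R^K never have to be compared
    with it. *)
Lemma measurable_sublinear (phi : 'rV[R]_K -> R) :
  subadditive phi -> positive_homogeneous phi -> measurable_fun setT phi.
Proof.
move=> sub hom; have [c c0 phic] := sublinear_coord_bound sub hom.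
apply: (measurability _ (RGenInftyO.measurableE R)) => //.
move=> _ [_ [a ->] <-]; rewrite setTI.
pose grid (mv : nat * {ffun 'I_K -> int}) : 'rV[R]_K :=
  \row_j ((mv.2 j)%:~R / mv.1.+1%:R).
pose box mv : set 'rV[R]_K :=
  \bigcap_(j in [set: 'I_K]) [set x | `|x ord0 j - grid mv ord0 j| <= mv.1.+1%:R^-1].
rewrite (_ : _ @^-1` _ = \bigcup_mv
  (box mv `&` [set _ | phi (grid mv) + c * mv.1.+1%:R^-1 < a])).
  apply: countable_bigcupT_measurable; first exact: countableP.
  move=> mv; apply: measurableI; last first.
    exact/measurable_bool_set/measurable_cst.
  apply: fin_bigcap_measurable => // j _.
  apply/measurable_bool_set/measurable_fun_ler; last exact: measurable_cst.
  apply: measurableT_comp => //; apply: measurable_funB; last exact: measurable_cst.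
  exact: measurable_coord.
have near_le (u v : 'rV[R]_K) (e : R) : (forall j, `|u ord0 j - v ord0 j| <= e) ->
    phi u <= phi v + c * e.
  move=> uv; rewrite -{1}(subrK v u) addrC; apply: (le_trans (sub _ _)).
  by rewrite lerD2l; apply: phic => j; rewrite !mxE.
apply/seteqP; split => [x /=|x [mv _] [/= xmv]].
  rewrite in_itv /= => xa.
  (* The mesh is paid for twice: once to go from [x] to the grid point, once
     in the condition that selects the grid point. *)
  have [m mlarge] : exists m : nat, 2 * c / (a - phi x) < m.+1%:R.
    exists (Num.bound (2 * c / (a - phi x))).
    rewrite (lt_trans (archi_boundP _)) ?ltr_nat //.
    by rewrite divr_ge0 ?mulr_ge0 // subr_ge0 ltW.
  have xg j : `|x ord0 j - grid (m, [ffun j => Num.floor (x ord0 j * m.+1%:R)]) ord0 j|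
      <= m.+1%:R^-1.
    rewrite mxE /= ffunE -[X in X - _](@mulfK _ m.+1%:R) ?pnatr_eq0 // -mulrBl.
    rewrite normrM [X in _ * X]gtr0_norm ?invr_gt0 ?ltr0n //.
    rewrite ler_piMl ?invr_ge0 ?ler0n // ger0_norm ?subr_ge0 ?floor_le //.
    by rewrite lerBlDl; have /ltW := floorD1_gt (x ord0 j * m.+1%:R); rewrite intrD.
  eexists; first by []. split; [exact: (fun j _ => xg j)|].
  rewrite /=.
  apply: (@le_lt_trans _ _ (phi x + c * m.+1%:R^-1 + c * m.+1%:R^-1)).
    by rewrite lerD2r near_le // => j; rewrite distrC.
  rewrite -addrA -ltrBrDl -mulrDl -mulr2n -(mulr_natl c 2) ltr_pdivrMr ?ltr0n //.
  by rewrite [X in _ < X]mulrC -ltr_pdivrMr ?subr_gt0.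
rewrite in_itv /=; apply: le_lt_trans.
exact/near_le/(fun j => xmv j I).
Qed.

End vector_measurability.

(** * Sign patterns and Rademacher weights *)

Lemma mutually_independent_all d d' (T : measurableType d)
    (T' : measurableType d') (R : realType) (P : probability T R) (I : finType)
    (X : I -> T -> T') (B : I -> set T') :
  mutually_independent P X -> (forall i, measurable (B i)) ->
  P (\bigcap_(i in [set: I]) (X i @^-1` B i)) = (\prod_i P (X i @^-1` B i))%E.
Proof.
move=> Xindep mB; have := Xindep [set: I]%SET B mB.
rewrite (_ : [set` [set: I]%SET] = setT); last first.
  by apply/seteqP; split => i //=; rewrite inE.
by move=> ->; apply: eq_bigl => i; rewrite inE.
Qed.

Section sign_patterns.
Context {R : realType} {n : nat}.
Implicit Types (S U : {set 'I_n}) (p q : {set 'I_n} -> bool).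

(** Sign patterns are indexed by the set of positive coordinates, so that counting
    patterns by their number of [+1] is counting subsets by cardinality. *)
Definition signs S (i : 'I_n) : R := if i \in S then 1 else -1.

Definition sign_freq p : R := 2^-1 ^+ n * #|[set S | p S]%SET|%:R.

Lemma sign_freq_le p q : (forall S, p S -> q S) -> sign_freq p <= sign_freq q.
Proof.
move=> pq; rewrite ler_wpM2l ?exprn_ge0 ?invr_ge0 // ler_nat.
by apply/subset_leq_card/fintype.subsetP => S; rewrite !inE; exact: pq.
Qed.

Lemma sign_freqU p q : sign_freq (fun S => p S || q S) <= sign_freq p + sign_freq q.
Proof.
rewrite -mulrDr ler_wpM2l ?exprn_ge0 ?invr_ge0 // -natrD ler_nat.
apply: (leq_trans _ ((leq_card_setU [set S | p S]%SET [set S | q S]%SET).1)).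
by apply/subset_leq_card/fintype.subsetP => S; rewrite !inE.
Qed.

Lemma sign_freq_involution (h : {set 'I_n} -> {set 'I_n}) p :
  involutive h -> sign_freq (fun S => p (h S)) = sign_freq p.
Proof.
move=> hK; congr (_ * _%:R); rewrite -(card_imset _ (inv_inj hK)).
apply: eq_card => S; rewrite inE; apply/imsetP/idP => [[U + ->]|pS].
  by rewrite inE.
by exists (h S); rewrite ?inE hK.
Qed.

Lemma half_expn_card : 2^-1 ^+ n * #|{set 'I_n}|%:R = 1 :> R.
Proof.
by rewrite -cardsT -powersetT card_powerset cardsT card_ord natrX
  -exprMn mulVf ?expr1n // pnatr_eq0.
Qed.

Lemma sign_freqT p : (forall S, p S) -> sign_freq p = 1.
Proof.
move=> pT; rewrite /sign_freq (_ : [set S | p S]%SET = [set: {set 'I_n}]%SET).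
  by rewrite cardsT half_expn_card.
by apply/setP => S; rewrite !inE pT.
Qed.

Lemma signs_inj S U : signs S =1 signs U -> S = U.
Proof.
move=> SU; apply/setP => i; have := SU i; rewrite /signs.
have N1 : (1 == -1 :> R) = false by rewrite eq_sym lt_eqF // ltrN10.
by do 2 case: ifP => _ //; move/eqP; rewrite ?N1 // eq_sym N1.
Qed.

(** The [2 ^ n] atoms on which the weights equal a given pattern are disjoint and
    have probability [2 ^- n] by independence, so they exhaust the probability
    space up to a null set. Weights may take other values than [+1] and [-1] on
    that null set, which is why the event is first intersected with the union
    of the atoms. From here on every probability over the weights is a count. *)
Lemma rademacher_prob d (T : measurableType d) (P : probability T R)
    (W : 'I_n -> {RV P >-> R}) (p : ('I_n -> R) -> bool) :
  mutually_independent P (fun i w => W i w) ->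
  (forall i, rademacher P (W i)) ->
  measurable [set w | p (fun i => W i w)] ->
  P [set w | p (fun i => W i w)] = (sign_freq (fun S => p (signs S)))%:E.
Proof.
move=> Windep Wrad mE; set E := [set w | _].
pose A S : set T := \bigcap_(i in [set: 'I_n]) (W i @^-1` [set signs S i]).
have mW i (r : R) : measurable (W i @^-1` [set r]).
  by rewrite -[X in measurable X]setTI; exact: measurable_funPT.
have mA S : measurable (A S) by apply: fin_bigcap_measurable => // i _.
have AE S w : A S w -> (fun i => W i w) = signs S.
  by move=> ASw; apply/funext => i; exact: ASw.
have PA S : P (A S) = (2^-1 ^+ n)%:E.
  rewrite (mutually_independent_all Windep (fun=> measurable_set1 _)).
  rewrite (eq_bigr (fun=> (2^-1)%:E)) => [|i _].
    by rewrite prodEFin prodr_const card_ord.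
  by rewrite /signs; case: ifP => _; case: (Wrad i).
have tA : trivIset setT A.
  apply/trivIsetP => S U _ _ SU; apply/seteqP; split => // w [wS wU].
  by move/eqP: SU; apply; apply: signs_inj => i; rewrite -(AE _ _ wS) -(AE _ _ wU).
have PU (D : {set {set 'I_n}}) : P (\bigcup_(S in [set` D]) A S) =
    (2^-1 ^+ n * #|D|%:R)%:E.
  rewrite (_ : [set` D] = [set` enum D]); last first.
    by apply/seteqP; split => S /=; rewrite mem_enum.
  rewrite measure_fin_bigcup //; last exact: sub_trivIset tA.
  rewrite -fsbig_seq ?enum_uniq // big_enum /=.
  by rewrite (eq_bigr (fun=> (2^-1 ^+ n)%:E)) // sumEFin sumr_const mulr_natr.
have mU (D : {set {set 'I_n}}) : measurable (\bigcup_(S in [set` D]) A S).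
  by apply: fin_bigcup_measurable.
have PC : P (~` \bigcup_(S in [set` [set: {set 'I_n}]%SET]) A S) = 0%E.
  by rewrite probability_setC // PU cardsT half_expn_card subee.
set full := \bigcup_(S in _) A S in PC.
have mfull : measurable full by exact: mU.
have -> : P E = (P (E `\` full) + P (E `&` full))%E by exact: measureDI.
rewrite /sign_freq -PU.
rewrite (_ : P (E `\` _) = 0%E) ?add0e; last first.
  apply/eqP; rewrite -measure_le0 -PC.
  apply: le_measure; rewrite ?inE; [exact: measurableD|exact: measurableC|].
  by rewrite setDE; exact: subIsetr.
congr (P _); apply/seteqP; split => [w [Ew [S _ ASw]]|w [S pS ASw]].
  by exists S => //=; rewrite inE -(AE _ _ ASw).
split; last by exists S => //=; rewrite inE.
by move: pS; rewrite /= inE /E /= (AE _ _ ASw).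
Qed.

End sign_patterns.

(** * The resampled quantile as an order statistic *)

Section quantile.
Context {R : realType} {n : nat}.
Implicit Types (F : {set 'I_n} -> R) (a x : R).

Lemma sign_freq0 (p : {set 'I_n} -> bool) :
  (forall S, ~~ p S) -> sign_freq p = 0 :> R.
Proof.
move=> pF; rewrite /sign_freq (_ : [set S | p S]%SET = finset.set0).
  by rewrite cards0 mulr0.
by apply/setP => S; rewrite !inE (negbTE (pF S)).
Qed.

(** The infimum defining the quantile is attained: the tail frequency of a finite
    family is a right-continuous step function. If the frequency above [x]
    exceeds [a], it still does up to the smallest value [F S1] above [x], which
    is then a lower bound of the set. Nonnegativity of [F] and [a < 1] bound the
    set below, so that the infimum is a genuine one. *)
Lemma sign_freq_quantile_le F a x : (forall S, 0 <= F S) -> 0 <= a < 1 ->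
  (inf [set z | sign_freq (fun S => z < F S) <= a] <= x) =
  (sign_freq (fun S => x < F S) <= a).
Proof.
move=> F0 /andP[a0 a1]; set A := [set z | _].
apply/idP/idP => [|xA]; last first.
  apply: ge_inf => //; exists 0 => z Az; rewrite leNgt; apply/negP => z0.
  have /le_lt_trans/(_ a1) := Az; rewrite sign_freqT ?ltxx // => S.
  exact: lt_le_trans (F0 S).
apply: contraTT; rewrite -!ltNge => aF.
have [S0 xS0] : exists S, x < F S.
  apply/existsP; apply: contraTT aF => /existsPn xF.
  by rewrite -leNgt sign_freq0.
case: (@arg_minP _ _ _ S0 (fun S => x < F S) F xS0) => S1 xS1 minS1.
apply: (lt_le_trans xS1); apply: lb_le_inf.
  exists (\sum_S F S); rewrite /A /= sign_freq0 // => S.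
  by rewrite -leNgt (bigD1 S) //= lerDl sumr_ge0.
move=> z Az; rewrite leNgt; apply/negP => zS1.
have /le_lt_trans/(_ aF) := Az; apply/negP; rewrite -leNgt.
by apply: sign_freq_le => S xS; exact: lt_le_trans (minS1 _ xS).
Qed.

Context {K : nat} (phi : 'rV[R]_K -> R).
Hypotheses (phi_ge0 : forall v, 0 <= phi v) (phi_sub : subadditive phi)
  (phi_hom : positive_homogeneous phi).
Context {dW : measure_display} {TW : measurableType dW} (PW : probability TW R)
  (W : 'I_n -> {RV PW >-> R}).
Hypotheses (Windep : mutually_independent PW (fun i w => W i w))
  (Wrad : forall i, rademacher PW (W i)).

Notation quantile := (resampled_quantile PW (fun i w => W i w)).

(** The Galois connection between quantile and tail frequency: comparisons with
    the quantile become comparisons of counts. It is the only property of the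
    quantile used below. *)
Lemma resampled_quantile_le a y x : 0 <= a < 1 ->
  (quantile a phi y <= x) =
  (sign_freq (fun S => x < phi (resampled_mean y (signs S))) <= a).
Proof.
move=> a01.
rewrite -(sign_freq_quantile_le (F := fun S => phi (resampled_mean y (signs S)))) //.
congr (inf _ <= x); apply/seteqP; split => z /=;
  rewrite (rademacher_prob (p := fun w => z < phi (resampled_mean y w))) //;
  apply/measurable_bool_set/measurable_fun_ltr => //;
  apply: measurableT_comp; (try exact: measurable_sublinear);
  exact: (measurable_resampled_mean (y := fun=> y)).
Qed.

Lemma measurable_resampled_quantile a : 0 <= a < 1 ->
  measurable_fun setT (quantile a phi).
Proof.
move=> a01; apply: (measurability _ (RGenOInfty.measurableE R)) => //.
move=> _ [_ [x ->] <-]; rewrite setTI.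
rewrite (_ : _ @^-1` _ = [set y | a < sign_freq
  (fun S => x < phi (resampled_mean y (signs S)))]); last first.
  apply/funext => y; apply/propext.
  by rewrite /= in_itv /= andbT ltNge resampled_quantile_le // -ltNge.
apply/measurable_bool_set/measurable_fun_ltr => //.
apply: measurable_funM => //.
rewrite (_ : (fun _ => _) = fun y : n.-tuple 'rV[R]_K =>
  \sum_(S : {set 'I_n}) \1_[set y | x < phi (resampled_mean y (signs S))] y).
  apply: measurable_sum => S; apply: measurable_indic.
  apply/measurable_bool_set/measurable_fun_ltr => //.
  apply: measurableT_comp; first exact: measurable_sublinear.
  exact: (measurable_resampled_mean (w := fun i _ => signs S i)).
apply/funext => y; rewrite -sum1_card natr_sum big_mkcond /=.
apply: eq_bigr => S _; rewrite inE indicE.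
by case: ifPn => h; [rewrite mem_set|rewrite memNset //; exact/negP].
Qed.

End quantile.

(** * Laws of random tuples *)

Lemma mutually_independent_comp d d1 d2 (T : measurableType d)
    (T1 : measurableType d1) (T2 : measurableType d2) (R : realType)
    (P : probability T R) (I : finType) (X : I -> T -> T1) (g : T1 -> T2) :
  measurable_fun setT g -> mutually_independent P X ->
  mutually_independent P (fun i t => g (X i t)).
Proof.
move=> mg Xindep J B mB; apply: (Xindep J (fun i => g @^-1` B i)) => i.
by rewrite -[X in measurable X]setTI; exact: mg.
Qed.

(** Cylinders with measurable bases form a pi-system that generates the
    sigma-algebra of tuples, so a law on tuples is determined by its values on
    them. *)
Lemma tuple_law_unique d d' (T : measurableType d) (T' : measurableType d')
    (R : realType) (P : probability T R) n (X X' : T -> n.-tuple T') :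
  measurable_fun setT X -> measurable_fun setT X' ->
  (forall B : 'I_n -> set T', (forall i, measurable (B i)) ->
    P (\bigcap_(i in [set: 'I_n]) [set t | B i (tnth (X t) i)]) =
    P (\bigcap_(i in [set: 'I_n]) [set t | B i (tnth (X' t) i)])) ->
  forall A, measurable A -> P (X @^-1` A) = P (X' @^-1` A).
Proof.
move=> mX mX' XX' A mA.
pose Xm : {mfun T >-> n.-tuple T'} := HB.pack X (isMeasurableFun.Build _ _ _ _ X mX).
pose Xm' : {mfun T >-> n.-tuple T'} := HB.pack X' (isMeasurableFun.Build _ _ _ _ X' mX').
pose cylinder (B : 'I_n -> set T') : set (n.-tuple T') :=
  \bigcap_(i in [set: 'I_n]) [set x | B i (tnth x i)].
pose G := [set C | exists2 B, (forall i, measurable (B i)) & C = cylinder B].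
have mcyl B : (forall i, measurable (B i)) -> measurable (cylinder B).
  move=> mB; apply: fin_bigcap_measurable => // i _.
  rewrite -[X in measurable X]setTI.
  exact: (measurable_tnth i measurableT (mB i)).
have GT : G setT.
  by exists (fun=> setT) => //; apply/seteqP; split.
apply: (measure_unique G (fun=> setT) _ _ _ _
  (pushforward P Xm) (pushforward P Xm')) => //.
- apply/seteqP; split; last first.
    apply: smallest_sub; first exact: sigma_algebra_measurable.
    by move=> C [B mB ->]; exact: mcyl.
  apply: smallest_sub; first exact: smallest_sigma_algebra.
  move=> C; rewrite -bigcup_seq => -[i _ [B mB <-]].
  apply: sub_sigma_algebra; exists (fun j => if j == i then B else setT).
    by move=> j; case: ifP.
  apply/seteqP; split => x /=; rewrite /cylinder /=.
    by move=> [_ Bx] j _ /=; case: eqP => // ->.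
  by move=> /(_ i I) /=; rewrite eqxx.
- move=> C D [B mB ->] [B' mB' ->].
  exists (fun i => B i `&` B' i); first by move=> i; exact: measurableI.
  by rewrite /cylinder -bigcapI.
- by rewrite bigcup_const.
- by move=> C [B mB ->]; exact: XX'.
- by move=> _; apply: le_lt_trans (probability_le1 P measurableT) (ltry 1%R).
Qed.

(** * Symmetrization *)

Section sign_flip.
Context {R : realType} {n K : nat}.
Implicit Types (S U : {set 'I_n}) (z : n.-tuple 'rV[R]_K).

Definition flip_signs S z : n.-tuple 'rV[R]_K := [tuple signs S i *: tnth z i | i < n].

(** The pattern whose signs are the products of those of [S] and [U]. *)
Definition sign_mul S U : {set 'I_n} := [set i | (i \in S) == (i \in U)]%SET.

Lemma sign_mulK S : involutive (sign_mul S).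
Proof. by move=> U; apply/setP => i; rewrite !inE; do 2 case: (_ \in _). Qed.

Lemma signs_mul S U i : signs (sign_mul S U) i = signs S i * signs U i :> R.
Proof.
by rewrite /signs inE; do 2 case: (_ \in _); rewrite /= ?mulrNN ?mul1r ?mulr1.
Qed.

Lemma sample_mean_flip_signs S z : sample_mean (flip_signs S z) = resampled_mean z (signs S).
Proof.
by congr (_ *: _); apply: eq_bigr => i _; rewrite tnth_mktuple.
Qed.

Lemma resampled_mean_flip_signs S U z :
  resampled_mean (flip_signs S z) (signs U) = resampled_mean z (signs (sign_mul S U)).
Proof.
congr (_ *: _); apply: eq_bigr => i _.
by rewrite tnth_mktuple scalerA signs_mul mulrC.
Qed.

End sign_flip.

Section symmetrization.
Context {R : realType} {n K : nat} (phi : 'rV[R]_K -> R).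
Hypotheses (phi_ge0 : forall v, 0 <= phi v) (phi_sub : subadditive phi)
  (phi_hom : positive_homogeneous phi).
Context {dW : measure_display} {TW : measurableType dW} (PW : probability TW R)
  (W : 'I_n -> {RV PW >-> R}).
Hypotheses (Windep : mutually_independent PW (fun i w => W i w))
  (Wrad : forall i, rademacher PW (W i)).
Context {d : measure_display} {T : measurableType d} (P : probability T R)
  (Z : T -> n.-tuple 'rV[R]_K).
Hypotheses (mZ : measurable_fun setT Z)
  (Zindep : mutually_independent P (fun i t => tnth (Z t) i))
  (Zsym : forall i,
    same_distribution P (fun t => tnth (Z t) i) (fun t => - tnth (Z t) i)).

Notation quantile := (resampled_quantile PW (fun i w => W i w)).

(** Multiplying the data by fixed signs permutes the sign patterns, and the
    quantile depends only on the family of values over all patterns. *)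
Lemma resampled_quantile_flip_signs a S z : 0 <= a < 1 ->
  quantile a phi (flip_signs S z) = quantile a phi z.
Proof.
move=> a01; have E x : (quantile a phi (flip_signs S z) <= x) = (quantile a phi z <= x).
  rewrite !resampled_quantile_le // -[in RHS](sign_freq_involution _ (sign_mulK S)).
  by under [in RHS]eq_fun do rewrite -resampled_mean_flip_signs.
by apply/eqP; rewrite eq_le E lexx -E lexx.
Qed.

(** The law of a vector with independent symmetric entries is invariant under sign
    changes of the entries: on cylinders this is the product formula together
    with the symmetry of each factor. *)
Lemma flip_signs_same_law S (A : set (n.-tuple 'rV[R]_K)) : measurable A ->
  P (Z @^-1` A) = P ((fun t => flip_signs S (Z t)) @^-1` A).
Proof.
pose X i t := tnth (Z t) i.
have mX i : measurable_fun setT (X i) by exact: measurableT_comp (measurable_tnth i) mZ.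
move=> mA; apply: tuple_law_unique mA => [//||B mB].
  apply/measurable_fun_tnthP => i.
  rewrite (_ : _ \o _ = fun t => signs S i *: X i t).
    exact: measurable_fun_rVZ.
  by apply/funext => t /=; rewrite tnth_mktuple.
transitivity (\prod_i P (X i @^-1` B i))%E; first exact: mutually_independent_all.
transitivity (\prod_i P (X i @^-1` ((fun x => signs S i *: x) @^-1` B i)))%E.
  apply: eq_bigr => i _; rewrite -comp_preimage /signs; case: ifP => _.
    by congr (P _); apply/seteqP; split => t /=; rewrite scale1r.
  rewrite (Zsym _ (mB i)).
  by congr (P _); apply/seteqP; split => t /=; rewrite scaleN1r.
rewrite -mutually_independent_all //.
  congr (P _); apply: eq_bigcapr => i _.
  by apply/seteqP; split => t /=; rewrite tnth_mktuple.
move=> i; rewrite -[X in measurable X]setTI.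
have mS : measurable_fun setT (fun x : 'rV[R]_K => signs S i *: x).
  exact: measurable_fun_rVZ.
exact: mS.
Qed.

(** The exact level of the symmetrized test. By sign invariance of the law and of
    the quantile, the probability is the same with the mean replaced by the
    mean resampled along any fixed pattern [S]. Averaging over [S] exchanges the
    sum with the expectation, and inside the expectation the frequency of the
    patterns whose resampled mean exceeds the quantile is at most [a] by the
    definition of the quantile. *)
Lemma resampled_quantile_level a : 0 <= a < 1 ->
  (P [set t | (quantile a phi (Z t) < phi (sample_mean (Z t)))%R] <= a%:E)%E.
Proof.
move=> a01.
pose A := [set z : n.-tuple 'rV[R]_K | quantile a phi z < phi (sample_mean z)].
pose B S := [set t | quantile a phi (Z t) <
  phi (resampled_mean (Z t) (signs S))].
have mquant := measurable_resampled_quantile phi_ge0 phi_sub phi_hom Windep Wrad a01.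
have mphi := measurable_sublinear phi_sub phi_hom.
have mA : measurable A.
  apply/measurable_bool_set/measurable_fun_ltr => //.
  by apply: measurableT_comp => //; exact: measurable_sample_mean.
have mB S : measurable (B S).
  apply/measurable_bool_set/measurable_fun_ltr.
    exact: measurableT_comp mZ.
  apply: measurableT_comp => //.
  exact: (measurable_resampled_mean (w := fun i _ => signs S i)).
have PB S : P (Z @^-1` A) = P (B S).
  rewrite (flip_signs_same_law S mA); congr (P _).
  by apply/seteqP; split => t; rewrite /A /B /= sample_mean_flip_signs
    resampled_quantile_flip_signs.
rewrite -/(Z @^-1` A).
set N : R := #|{set 'I_n}|%:R; have := @half_expn_card R n; rewrite -/N => N1.
have N0 : 0 < N by rewrite ltr0n; apply/card_gt0P; exists finset.set0.
have sumB : (\sum_(S : {set 'I_n}) P (B S) <= (N * a)%:E)%E.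
  rewrite (eq_bigr (fun S => \int[P]_t (\1_(B S) t)%:E)%E); last first.
    by move=> S _; rewrite integral_indic // setIT.
  have m1 S : measurable_fun setT (fun t => (\1_(B S) t : R)%:E).
    exact/measurable_EFinP/measurable_indic.
  rewrite -ge0_integral_sum //.
  have -> : (N * a)%:E = (\int[P]_t (cst (N * a)%:E t))%E.
    rewrite integral_cst // [X in (_ * X)%E](_ : _ = 1%E) ?mule1 //.
    exact: probability_setT.
  apply: ge0_le_integral => //.
  - by move=> t _; apply: sume_ge0 => S _; rewrite lee_fin.
  - exact: emeasurable_sum.
  move=> t _; rewrite sumEFin lee_fin /=.
  rewrite (_ : \sum_S _ = N * sign_freq (fun S => quantile a phi (Z t) <
    phi (resampled_mean (Z t) (signs S)))).
    rewrite ler_pM2l //.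
    by rewrite -(resampled_quantile_le phi_ge0 phi_sub phi_hom Windep Wrad).
  rewrite /sign_freq mulrA [N * _]mulrC N1 mul1r -sum1_card natr_sum.
  rewrite [RHS]big_mkcond /=; apply: eq_bigr => S _; rewrite finset.inE indicE /B.
  by case: ifPn => h; [rewrite mem_set|rewrite memNset //; exact/negP].
have Afin : P (Z @^-1` A) \is a fin_num.
  by rewrite (PB finset.set0) fin_num_measure.
move: sumB; rewrite (eq_bigr (fun=> P (Z @^-1` A))) => [|S _]; last exact: esym (PB S).
rewrite -(fineK Afin) sumEFin !lee_fin sumr_const -mulr_natl.
by rewrite ler_pM2l.
Qed.

End symmetrization.

(** * Binomial tails and the cost of recentering *)

Section binomial.
Context {R : realType} {n : nat}.

(** The number of positive signs in a uniform pattern is binomial [(n, 1/2)]. *)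
Lemma sign_freq_card_gt k :
  sign_freq (fun S : {set 'I_n} => k < #|S|)%N =
  2^-1 ^+ n * \sum_(k.+1 <= i < n.+1) 'C(n, i)%:R :> R.
Proof.
rewrite /sign_freq -natr_sum; congr (_ * _%:R).
transitivity (\sum_(k.+1 <= i < n.+1) \sum_(S : {set 'I_n}) (#|S| == i : nat))%N.
  rewrite exchange_big -sum1_card big_mkcond /=; apply: eq_bigr => S _.
  transitivity (count_mem #|S| (index_iota k.+1 n.+1)).
    rewrite count_uniq_mem ?iota_uniq // mem_index_iota ltnS inE.
    by rewrite -[X in _ && (_ <= X)%N](card_ord n) max_card andbT; case: ltnP.
  rewrite -sum1_count big_mkcond; apply: eq_bigr => i _ /=.
  by rewrite eq_sym; case: eqP.
apply: eq_bigr => i _.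
rewrite -[n in RHS](card_ord n) -card_draws -sum1_card [RHS]big_mkcond /=.
by apply: eq_bigr => S _; rewrite inE; case: eqP.
Qed.

Lemma binom_upper_quantile_lt (eta : R) : 0 < eta ->
  sign_freq (fun S : {set 'I_n} => binom_upper_quantile n eta < #|S|)%N < eta.
Proof.
move=> eta0; rewrite sign_freq_card_gt /binom_upper_quantile.
case: arg_minnP => //=.
by rewrite big_geq // mulr0.
Qed.

Lemma sum_signs (S : {set 'I_n}) : \sum_i signs S i = 2 * #|S|%:R - n%:R :> R.
Proof.
rewrite (eq_bigr (fun i => 2 * (i \in S)%:R - 1)) => [|i _]; last first.
  by rewrite /signs; case: ifP => _; rewrite ?mulr1 ?mulr0 ?add0r // -addrA subrr addr0.
rewrite big_split /= -mulr_sumr -natr_sum sumrN sumr_const card_ord.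
by congr (2 * _%:R - _); rewrite -sum1_card [RHS]big_mkcond.
Qed.

Lemma signsC (S : {set 'I_n}) i : signs (~: S)%SET i = - signs S i :> R.
Proof. by rewrite /signs inE; case: (_ \in _); rewrite /= ?opprK. Qed.

End binomial.

Section deterministic.
Context {R : realType} {n K : nat} (phi : 'rV[R]_K -> R).
Hypotheses (n_gt0 : (0 < n)%N) (phi_ge0 : forall v, 0 <= phi v)
  (phi_sub : subadditive phi) (phi_hom : positive_homogeneous phi).

Let nR0 : (n%:R : R) != 0. Proof. by rewrite pnatr_eq0 -lt0n. Qed.

Lemma sample_mean_recenter (y : n.-tuple 'rV[R]_K) mu :
  sample_mean (recenter y mu) = sample_mean y - mu.
Proof.
rewrite /sample_mean (eq_bigr (fun i => tnth y i - mu)); last first.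
  by move=> i _; rewrite tnth_mktuple.
rewrite sumrB sumr_const card_ord scalerBr -(scaler_nat _ mu) scalerA mulVf //.
by rewrite scale1r.
Qed.

(** Recentering at the empirical mean rather than at [mu] shifts the resampled
    mean by the average weight times the deviation of the empirical mean. *)
Lemma resampled_mean_recenter (y : n.-tuple 'rV[R]_K) mu w :
  resampled_mean (recenter y mu) w =
  resampled_mean (recenter y (sample_mean y)) w +
  (n%:R^-1 * \sum_i w i) *: (sample_mean y - mu).
Proof.
rewrite /resampled_mean -scalerA -scalerDr scaler_suml -big_split /=.
congr (_ *: _); apply: eq_bigr => i _.
by rewrite !tnth_mktuple -scalerDr addrA subrK.
Qed.

Lemma sym_max_ge0 v : 0 <= sym_max phi v.
Proof. by rewrite le_max phi_ge0. Qed.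

Lemma sublinearZ_sym_max t v : phi (t *: v) <= `|t| * sym_max phi v.
Proof.
have [t0|t0] := leP 0 t.
  by rewrite phi_hom // ger0_norm // ler_wpM2l // le_max lexx.
have nt : 0 <= - t by rewrite oppr_ge0 ltW.
rewrite (ltr0_norm t0) -{1}[t]opprK scaleNr -scalerN phi_hom // ler_wpM2l //.
by rewrite le_max lexx orbT.
Qed.

(** The average sign [t] is symmetric and [phi (t *: v) <= |t| * sym_max phi v], so
    the patterns with [c < t * sym_max phi v] have frequency above [eta / 2]. If the conclusion failed, each of these would have
    more positive signs than the binomial quantile at [eta / 2], and such
    patterns have frequency below [eta / 2]. *)
Lemma mean_sign_deviation (eta c : R) v : 0 < eta -> 0 <= c ->
  eta < sign_freq (fun S : {set 'I_n} => c < phi ((n%:R^-1 * \sum_i signs S i) *: v)) ->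
  n%:R * c < (2 * (binom_upper_quantile n (eta / 2))%:R - n%:R) * sym_max phi v.
Proof.
move=> eta0 c0; apply: contraTT; rewrite -!leNgt => Dc.
set m := sym_max phi v in Dc *; have m0 : 0 <= m by exact: sym_max_ge0.
pose p (S : {set 'I_n}) : bool := c < n%:R^-1 * (\sum_i signs S i) * m.
have pC : sign_freq (fun S => p (~: S)%SET) = sign_freq p :> R.
  exact: sign_freq_involution (@finset.setCK _).
(* The sign of the average decides which of a pattern and its complement
   satisfies [p]. *)
apply: (@le_trans _ _ (sign_freq (fun S => p S || p (~: S)%SET))).
  apply: sign_freq_le => S /lt_le_trans/(_ (sublinearZ_sym_max _ _)).
  rewrite -/m /p (eq_bigr _ (fun i _ => signsC S i)) sumrN mulrN.
  by case: ger0P => _ ->; rewrite ?orbT.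
apply: (le_trans (sign_freqU _ _)); rewrite pC.
suff pB : sign_freq p <= eta / 2 by rewrite [eta]splitr lerD.
have eta2 : 0 < eta / 2 by rewrite divr_gt0.
apply: (le_trans _ (ltW (binom_upper_quantile_lt (n := n) eta2))).
apply: sign_freq_le => S; rewrite /p sum_signs => cS.
have nc : n%:R * c < (2 * #|S|%:R - n%:R) * m.
  by rewrite mulrC -ltr_pdivlMr ?ltr0n // [_ / n%:R]mulrC mulrA.
have := le_lt_trans Dc nc; rewrite -(ltr_nat R) => Dm.
rewrite ltNge; apply/negP => SB; move: Dm; apply/negP; rewrite -leNgt.
by rewrite ler_wpM2r // lerD2r ler_wpM2l.
Qed.

Context {dW : measure_display} {TW : measurableType dW} (PW : probability TW R)
  (W : 'I_n -> {RV PW >-> R}).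
Hypotheses (Windep : mutually_independent PW (fun i w => W i w))
  (Wrad : forall i, rademacher PW (W i)).

Notation quantile := (resampled_quantile PW (fun i w => W i w)).

(** If the quantile around [mu] exceeds the one around the empirical mean by more
    than [c], then patterns exceeding the former level have frequency above
    [alpha]. Subadditivity sends each of them either above the empirical
    quantile, which accounts for at most [alpha * (1 - delta)], or to a
    deviation above [c] of the average sign times [sample_mean y - mu]. The
    latter therefore keep a frequency above [alpha * delta]. *)
Lemma quantile_recenter_gap (alpha delta c : R) (y : n.-tuple 'rV[R]_K) mu :
  0 < alpha < 1 -> 0 < delta < 1 -> 0 <= c ->
  quantile (alpha * (1 - delta)) phi (recenter y (sample_mean y)) + c <
    quantile alpha phi (recenter y mu) ->
  n%:R * c < (2 * (binom_upper_quantile n (alpha * delta / 2))%:R - n%:R) *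
    sym_max phi (sample_mean y - mu).
Proof.
move=> /andP[a0 a1] /andP[d0 d1] c0; set q := quantile _ _ _ => gap.
have b0 : 0 <= alpha * (1 - delta) < 1.
  by rewrite mulr_ge0 ?subr_ge0 1?ltW //= mulr_ilt1 ?subr_ge0 1?ltW // gtrBl.
apply: mean_sign_deviation => //; first exact: mulr_gt0.
have freq_gt : alpha <
    sign_freq (fun S => q + c < phi (resampled_mean (recenter y mu) (signs S))).
  have a01 : 0 <= alpha < 1 by rewrite ltW.
  rewrite ltNge -(resampled_quantile_le phi_ge0 phi_sub phi_hom Windep Wrad) //.
  by rewrite -ltNge.
have freq_le : sign_freq (fun S => q < phi (resampled_mean
    (recenter y (sample_mean y)) (signs S))) <= alpha * (1 - delta).
  by rewrite -(resampled_quantile_le phi_ge0 phi_sub phi_hom Windep Wrad).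
rewrite -(ltrD2l (alpha * (1 - delta))) -mulrDr subrK mulr1.
apply: (lt_le_trans freq_gt); apply: le_trans (lerD freq_le (lexx _)).
apply: le_trans (sign_freqU _ _); apply: sign_freq_le => S.
rewrite resampled_mean_recenter; apply: contraTT.
rewrite negb_or -!leNgt => /andP[? ?].
by apply: (le_trans (phi_sub _ _)); exact: lerD.
Qed.

End deterministic.

(** * The bound *)

Theorem proposition3p1
  (R : realType) (n K : nat) (hn : (2 <= n)%N) (hK : (1 <= K)%N)
  (d : measure_display) (T : measurableType d) (P : probability T R)
  (Y : 'I_n -> {RV P >-> 'rV[R]_K})
  (Yindep : mutually_independent P (fun i t => Y i t))
  (Yident : identically_distributed P (fun i t => Y i t))
  (Yint : forall i j, P.-integrable setT (fun t => (Y i t ord0 j)%:E))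
  (mu : 'rV[R]_K)
  (Ymean : forall i j, 'E_P[fun t => Y i t ord0 j]%E = (mu ord0 j)%:E)
  (Ysym : forall i,
     same_distribution P (fun t => Y i t - mu) (fun t => mu - Y i t))
  (dW : measure_display) (TW : measurableType dW) (PW : probability TW R)
  (W : 'I_n -> {RV PW >-> R})
  (Windep : mutually_independent PW (fun i w => W i w))
  (Wrad : forall i, rademacher PW (W i))
  (delta alpha : R)
  (hdelta : 0 < delta < 1) (halpha : 0 < alpha < 1)
  (f : n.-tuple 'rV[R]_K -> R)
  (fmeas : measurable_fun setT f) (f_ge0 : forall y, 0 <= f y)
  (phi : 'rV[R]_K -> R)
  (phi_ge0 : forall x, 0 <= phi x)
  (phi_sub : subadditive phi) (phi_hom : positive_homogeneous phi) :
  let sample t : n.-tuple 'rV[R]_K := [tuple Y i t | i < n] in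
  let mean t : 'rV[R]_K := sample_mean (sample t) in
  let q t : R := resampled_quantile PW (fun i w => W i w)
                   (alpha * (1 - delta)) phi (recenter (sample t) (mean t)) in
  let D : R :=
    2 * (binom_upper_quantile n (alpha * delta / 2))%:R - n%:R in
  (* when [D = 0], [n / D] is read as +oo and the event is empty *)
  (P [set t | (phi (mean t - mu) > q t + f (sample t))%R]
   <= alpha%:E
      + P [set t | (D != 0)%R /\
             (sym_max phi (mean t - mu) > n%:R / D * f (sample t))%R])%E.
Proof.
pose sample t : n.-tuple 'rV[R]_K := [tuple Y i t | i < n].
pose mean t : 'rV[R]_K := sample_mean (sample t).
pose q t : R := resampled_quantile PW (fun i w => W i w)
  (alpha * (1 - delta)) phi (recenter (sample t) (mean t)).
pose D : R := 2 * (binom_upper_quantile n (alpha * delta / 2))%:R - n%:R.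
pose E := [set t | q t + f (sample t) < phi (mean t - mu)].
pose E2 := [set t | D != 0 /\
  n%:R / D * f (sample t) < sym_max phi (mean t - mu)].
change (P E <= alpha%:E + P E2)%E.
have n_gt0 : (0 < n)%N by apply: leq_trans hn.
have n0 : 0 < n%:R :> R by rewrite ltr0n.
have /andP[a0 a1] := halpha; have /andP[d0 d1] := hdelta.
have a01 : (0 <= alpha < 1)%R by rewrite ltW.
have b01 : 0 <= alpha * (1 - delta) < 1.
  by rewrite mulr_ge0 ?subr_ge0 1?ltW //= mulr_ilt1 ?subr_ge0 1?ltW // gtrBl.
have mphi := measurable_sublinear phi_sub phi_hom.
have mY i : measurable_fun setT (Y i) by exact: measurable_funPT.
have msample : measurable_fun setT sample.
  apply/measurable_fun_tnthP => i; rewrite (_ : _ \o _ = Y i) //.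
  by apply/funext => t /=; rewrite tnth_mktuple.
have mmean : measurable_fun setT mean.
  exact: measurableT_comp (@measurable_sample_mean _ _ _) msample.
have mdev : measurable_fun setT (fun t => mean t - mu).
  exact: measurable_fun_rVB.
have mf : measurable_fun setT (fun t => f (sample t)) by exact: measurableT_comp.
have mrecenter v : measurable_fun setT v ->
    measurable_fun setT (fun t => recenter (sample t) (v t)).
  move=> mv; apply/measurable_fun_tnthP => i.
  rewrite (_ : _ \o _ = fun t => Y i t - v t); first exact: measurable_fun_rVB.
  by apply/funext => t /=; rewrite !tnth_mktuple.
have mquant a : 0 <= a < 1 -> measurable_fun setT
    (resampled_quantile PW (fun i w => W i w) a phi).
  exact: measurable_resampled_quantile.
have mq : measurable_fun setT q.
  exact: measurableT_comp (mquant _ b01) (mrecenter _ mmean).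
pose Z t := recenter (sample t) mu.
have mZ : measurable_fun setT Z by exact: mrecenter.
have ZE i : (fun t => tnth (Z t) i) = (fun t => Y i t - mu).
  by apply/funext => t; rewrite !tnth_mktuple.
have Zindep : mutually_independent P (fun i t => tnth (Z t) i).
  rewrite (_ : (fun i => _) = fun i t => Y i t - mu); last exact/funext.
  have mB : measurable_fun setT (fun x : 'rV[R]_K => x - mu).
    exact: measurable_fun_rVB.
  exact: mutually_independent_comp mB Yindep.
have Zsym i :
    same_distribution P (fun t => tnth (Z t) i) (fun t => - tnth (Z t) i).
  rewrite (_ : (fun t => - _) = fun t => mu - Y i t); first by rewrite ZE.
  by apply/funext => t; rewrite -opprB -[Y i t - mu](congr1 (@^~ t) (ZE i)).
have level := resampled_quantile_level phi_ge0 phi_sub phi_hom Windep Wrad mZ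
  Zindep Zsym a01.
set Q1 := [set t | _] in level.
have mQ1 : measurable Q1.
  apply/measurable_bool_set/measurable_fun_ltr.
    exact: measurableT_comp (mquant _ a01) mZ.
  apply: measurableT_comp => //.
  exact: measurableT_comp (@measurable_sample_mean _ _ _) mZ.
have mE : measurable E.
  apply/measurable_bool_set/measurable_fun_ltr; first exact: measurable_funD.
  exact: measurableT_comp.
have mE2 : measurable E2.
  rewrite (_ : E2 = [set t | (D != 0) &&
    (n%:R / D * f (sample t) < sym_max phi (mean t - mu))]); last first.
    by apply/seteqP; split => t /andP.
  apply/measurable_bool_set/measurable_and; first exact: measurable_cst.
  apply: measurable_fun_ltr; first exact: measurable_funM.
  apply: measurable_maxr; first exact: measurableT_comp.
  apply: measurableT_comp => //.
  rewrite (_ : (fun t => _) = fun t => mu - mean t); first exact: measurable_fun_rVB.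
  by apply/funext => t; rewrite opprB.
apply: (@le_trans _ _ (P (Q1 `|` E2))).
  apply: le_measure; rewrite ?inE //; first exact: measurableU.
  move=> t Et; have [Q1t|nQ1t] := pselect (Q1 t); [by left|right; move: nQ1t].
  (* Below the quantile around [mu], the excess of [phi (mean t - mu)] is an
     excess of that quantile over the one around the empirical mean. *)
  rewrite /Q1 /= /Z sample_mean_recenter // => /negP; rewrite -leNgt => Q1t.
  have := quantile_recenter_gap n_gt0 phi_ge0 phi_sub phi_hom Windep Wrad
    halpha hdelta (f_ge0 (sample t)) (lt_le_trans Et Q1t).
  rewrite -/(mean t) -/D => Dt.
  have D0 : 0 < D.
    rewrite ltNge; apply/negP => D_le0; move: Dt; apply/negP; rewrite -leNgt.
    rewrite (le_trans (mulr_le0_ge0 D_le0 (sym_max_ge0 phi_ge0 _))) //.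
    by rewrite mulr_ge0 // ltW.
  by split; [exact: lt0r_neq0|rewrite mulrAC ltr_pdivrMr // [X in _ < X]mulrC].
by apply: (le_trans (measureU2 _ mQ1 mE2)); exact: leeD.
Qed.
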